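(* Let $U_h,V_h$ (with values in $(V_h^k)^6$) be any solutions of the discrete variational equation: for all $j$ and all $\varphi\in(V_h^k)^6$, $$\int_{I_j}M\,dZ_h\cdot\varphi\,dx-\Big(\int_{I_j}KZ_h\cdot\varphi_x\,dx-\big(\widehat{KZ_h}\cdot\varphi^-\big)_{j+\frac12}+\big(\widehat{KZ_h}\cdot\varphi^+\big)_{j-\frac12}\Big)dt=\int_{I_j}\nabla^2S_1\,Z_h\cdot\varphi\,dx\,dt .$$ Then the following semi-discrete version of the multi-symplectic conservation law holds on every cell $I_j$: $$\int_{I_j}d(MU_h\cdot V_h)\,dx-\Big(\mathcal{F}_K(U_h,V_h)_{j+\frac12}-\mathcal{F}_K(U_h,V_h)_{j-\frac12}\Big)dt=0,$$ where $$\mathcal{F}_K(U_h,V_h)=\{KU_h\cdot V_h\}-\widehat{KU_h}\cdot\{V_h\}+\widehat{KV_h}\cdot\{U_h\}.$$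
   Context: A bounded interval $I$ is partitioned into cells $I_j=[x_{j-\frac12},x_{j+\frac12}]$, $j=1,\dots,N$. $V_h^k=\{v:v|_{I_j}\in P^k(I_j)\ \forall j\}$, with $P^k(I_j)$ the polynomials of degree at most $k$. $v^\pm_{j+\frac12}$ are the right ($+$) and left ($-$) limits at $x_{j+\frac12}$, $\{v\}=\frac12(v^++v^-)$, $[v]=v^+-v^-$; traces at the end points of $I$ are defined by periodicity. $d$ is the It\^o differential in time. The one-dimensional stochastic Maxwell equation $d\eta=-u_x\,dt-\lambda_1dW_t$, $du=-\eta_x\,dt+\lambda_2dW_t$ ($W_t$ a $Q$-Wiener process, $\lambda_1,\lambda_2$ real constants) is rewritten with $v_t=u$, $\zeta_t=\eta$, $P=u+\frac12\zeta_x$, $Q=\eta+\frac12v_x$ and $z=(u,\eta,v,\zeta,P,Q)^T$ as $$M\,dz+Kz_x\,dt=\nabla_zS_1(z)\,dt+\nabla_zS_2(z)\,dW_t,$$ $$S_1(z)=Pu+Q\eta-\tfrac{u^2}{2}-\tfrac{\eta^2}{2},\qquad S_2(z)=\lambda_1\zeta-\lambda_2v.$$ The $6\times6$ anti-symmetric matrices $M,K$ have as only non-zero entries $M_{35}=M_{46}=-1$, $M_{53}=M_{64}=1$; $K_{14}=K_{23}=\frac12$, $K_{32}=K_{41}=-\frac12$. $\nabla^2S_1$ is the (constant, symmetric) Hessian of $S_1$. The numerical flux is $$\widehat{Kz_h}=K\{z_h\}+A[z_h],$$ where the $6\times 6$ matrix $A$ has as only non-zero entries $A_{14}=A_{41}=m$,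 $A_{23}=A_{32}=n$, with $m,n\in\mathbb{R}$ and $n-m=\alpha$, $\alpha\in[-1,1]$ being the non-zero parameter of the fluxes $\check u_h=\{u_h\}+\alpha[u_h]$, $\check\eta_h=\{\eta_h\}-\alpha[\eta_h]$ of the DG method for $(u,\eta)$. The discrete variational equation in the claim is obtained by applying the exterior derivative to the corresponding DG scheme for $z_h\in(V_h^k)^6$ (the noise term drops because $S_2$ is linear). *)

(* Defs.v *)
From HB Require Import structures.
From mathcomp Require Import all_boot all_order all_algebra.
From mathcomp Require Import all_classical all_reals all_analysis.
Set Implicit Arguments.
Unset Strict Implicit.
Unset Printing Implicit Defensive.
Import Order.TTheory GRing.Theory Num.Theory.
Import numFieldNormedType.Exports.

Local Open Scope classical_set_scope.
Local Open Scope ring_scope.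

Section System.
Context {R : realType}.

(* The patterns give the usual 1-based row and column numbers. *)
Definition Mmat : 'M[R]_6 := \matrix_(i < 6, j < 6)
  match i.+1, j.+1 with
  | 3%N, 5%N | 4%N, 6%N => -1
  | 5%N, 3%N | 6%N, 4%N => 1
  | _, _ => 0
  end.

Definition Kmat : 'M[R]_6 := \matrix_(i < 6, j < 6)
  match i.+1, j.+1 with
  | 1%N, 4%N | 2%N, 3%N => 2^-1
  | 3%N, 2%N | 4%N, 1%N => - 2^-1
  | _, _ => 0
  end.

Definition Amat (m n : R) : 'M[R]_6 := \matrix_(i < 6, j < 6)
  match i.+1, j.+1 with
  | 1%N, 4%N | 4%N, 1%N => m
  | 2%N, 3%N | 3%N, 2%N => n
  | _, _ => 0
  end.

Definition dot (a b : 'cV[R]_6) : R := \sum_(i < 6) a i 0 * b i 0.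

(* z = (u, eta, v, zeta, P, Q)^T *)
Definition S1 (z : 'cV[R]_6) : R :=
  let u := z (inord 0) 0 in
  let eta := z (inord 1) 0 in
  let P := z (inord 4) 0 in
  let Q := z (inord 5) 0 in
  P * u + Q * eta - u ^+ 2 / 2 - eta ^+ 2 / 2.

Definition hessian (S : 'cV[R]_6 -> R) (z : 'cV[R]_6) : 'M[R]_6 :=
  \matrix_(i < 6, j < 6)
    'D_(delta_mx i 0) (fun y => 'D_(delta_mx j 0) S y) z.

(* S1 is quadratic: its Hessian is the same at every base point. *)
Definition hessS1 : 'M[R]_6 := hessian S1 0.

End System.

(* The mesh is x_{j + 1/2} = xs j for j = 0, ..., N, so that the cells are
   [xs j, xs j.+1] for j < N; values of xs beyond N are irrelevant. *)
Section Mesh.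
Context {R : realType}.
Variables (N : nat) (xs : nat -> R).

Definition is_mesh : Prop := forall j, (j < N)%N -> xs j < xs j.+1.

Definition cell (j : nat) : set R := `[xs j, xs j.+1]%classic.

(* Elements of V_h^k are discontinuous across the interfaces and are only
   defined up to their values there, hence the open cell. *)
Definition Vh (k : nat) (v : R -> R) : Prop :=
  forall j, (j < N)%N -> exists2 p : {poly R}, (size p <= k.+1)%N &
    forall y, xs j < y < xs j.+1 -> v y = p.[y].

Definition Vh6 (k : nat) (v : R -> 'cV[R]_6) : Prop :=
  forall i : 'I_6, Vh k (fun y => v y i 0).

(* One-sided limits at x_{j + 1/2}, periodic at the two end points: the left
   limit at x_{1/2} is the one at x_{N + 1/2}, and the right limit at
   x_{N + 1/2} is the one at x_{1/2}. *)
Definition tr_left (V : normedModType R) (f : R -> V) (j : nat) : V :=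
  lim (f y @[y --> (xs (if j == 0%N then N else j))^'-]).

Definition tr_right (V : normedModType R) (f : R -> V) (j : nat) : V :=
  lim (f y @[y --> (xs (if j == N then 0%N else j))^'+]).

Definition avg (V : normedModType R) (f : R -> V) (j : nat) : V :=
  2^-1 *: (tr_right f j + tr_left f j).

Definition jump (V : normedModType R) (f : R -> V) (j : nat) : V :=
  tr_right f j - tr_left f j.

Definition Kflux (m n : R) (Z : R -> 'cV[R]_6) (j : nat) : 'cV[R]_6 :=
  Kmat *m avg Z j + Amat m n *m jump Z j.

Definition FK (m n : R) (U V : R -> 'cV[R]_6) (j : nat) : R :=
  avg (fun y => dot (Kmat *m U y) (V y)) j
  - dot (Kflux m n U j) (avg V j) + dot (Kflux m n V j) (avg U j).

(* The factor of dt in the weak form on cell j tested with phi. *)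
Definition weak_drift (m n : R) (Z phi : R -> 'cV[R]_6) (j : nat) : R :=
  ((\int[lebesgue_measure]_(y in cell j) dot (Kmat *m Z y) (derive1 phi y))
   - dot (Kflux m n Z j.+1) (tr_left phi j.+1)
   + dot (Kflux m n Z j) (tr_right phi j))
  + \int[lebesgue_measure]_(y in cell j) dot (hessS1 *m Z y) (phi y).

End Mesh.

(* The identity dX = b dt on [0, T] between Ito differentials, for one sample
   path: as there is no dW term, it means X_t = X_0 + int_0^t b_s ds with b
   integrable. *)
Definition differential_dt {R : realType} (T : R) (X b : R -> R) : Prop :=
  lebesgue_measure.-integrable `[0, T]%classic (EFin \o b) /\
  forall t, 0 <= t <= T ->
    X t = X 0 + \int[lebesgue_measure]_(s in `[0, t]%classic) b s.

(* Z t w y is the value at time t, sample w and point y. *)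
Definition variational_solution {R : realType} {d : measure_display}
    {Omega : measurableType d} (P : probability Omega R) (T : R) (N : nat)
    (xs : nat -> R) (k : nat) (m n : R)
    (Z : R -> Omega -> R -> 'cV[R]_6) : Prop :=
  (forall t w, 0 <= t <= T -> Vh6 N xs k (Z t w)) /\
  forall (j : nat) (phi : R -> 'cV[R]_6), (j < N)%N -> Vh6 N xs k phi ->
    {ae P, forall w, differential_dt T
      (fun t => \int[lebesgue_measure]_(y in cell xs j)
                  dot (Mmat *m Z t w y) (phi y))
      (fun t => weak_drift N xs m n (Z t w) phi j)}.

(* Main.v *)
Require Import Defs.
From HB Require Import structures.
From mathcomp Require Import all_boot all_order all_algebra.
From mathcomp Require Import all_classical all_reals all_analysis.
From mathcomp Require Import measurable_realfun ring lra.
Set Implicit Arguments.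
Unset Strict Implicit.
Unset Printing Implicit Defensive.
Import Order.TTheory GRing.Theory Num.Theory.
Import numFieldNormedType.Exports.

Local Open Scope classical_set_scope.
Local Open Scope ring_scope.

(** Write [W_Z(phi)] for the drift of the weak form of [Z] on the cell, tested
    with [phi].  As [M] is antisymmetric, the law should follow from
    [d(MU.V) = W_U(V) - W_V(U)].  In this difference the Hessian terms cancel by
    symmetry, and the two volume terms with [K] combine, by antisymmetry, into
    the integral of the derivative of [KU.V], hence into boundary values.  At an
    interface the boundary terms seen from the left cell and those seen from the
    right cell agree, because [K] is antisymmetric and [A] symmetric, so both
    equal their average, which is the flux [F_K] ([interface_flux]).  The outcome
    is the identity [drift_antisym], valid at every time.

    The delicate point is the meaning of [d(MU.V)]: the equation is an integral
    identity for each fixed test function, [U] and [V] depend on time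
    themselves, and [M] has rank four, so that nothing is said directly about
    the evolution in time of the components [u] and [eta].  Everything is
    therefore expressed through finitely many coordinates, the moments against
    monomials on each cell; finitely many test functions also leave a single
    null set of sample paths to discard.  The moments of [MZ] are absolutely
    continuous in time.  Since [M^2 = -1] on the last four components and Gram
    matrices are invertible ([gram_unitmx]), the polynomial coefficients of
    these four components are absolutely continuous too ([lower_coef_Mmoment]).
    The integral of [MU.V] is a bilinear pairing of such functions, and is
    differentiated with the product rule [differential_dtM], a consequence of
    Fubini's theorem.

    The derivative found in this way involves the test components [v], [zeta],
    [P], [Q] only.  The rows of the drift tested with [u] and [eta] have to be
    added to reach [drift_antisym]; they vanish for almost every time, because
    the corresponding moments of [MZ] are identically zero
    ([upper_drift_ae_eq0]).  Modifying an integrand on a null set does not change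
    integrals, but it could destroy Borel measurability, which integrability in
    time requires of the right-hand side at all times.  It is restored by the
    same two rows: they express the moments of [u] and [eta], at every time, by
    measurable functions ([measurable_upper_moment]). *)

(** * Differentials in time *)

Section Calculus.
Context {R : realType}.
Notation mu := (@lebesgue_measure R).

Lemma measurable_integrand (D : set R) (f : R -> R) :
  mu.-integrable D (EFin \o f) -> measurable_fun D f.
Proof. by move=> h; apply/measurable_EFinP; exact: (measurable_int mu). Qed.

Lemma integrable_itv0 (T t : R) (a : R -> R) : t <= T ->
  mu.-integrable `[0, T] (EFin \o a) -> mu.-integrable `[0, t] (EFin \o a).
Proof.
move=> tT; apply: integrableS => //.
by apply: subset_itvl; rewrite bnd_simp.
Qed.

(** By Lebesgue differentiation of the vanishing primitive; the function is
    extended by zero so that the primitive vanishes on the whole line. *)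
Lemma ae_eq0_of_Rintegral0 (T : R) (D : R -> R) :
  mu.-integrable `[0, T] (EFin \o D) ->
  (forall t, 0 <= t <= T -> \int[mu]_(s in `[0, t]) D s = 0) ->
  {ae mu, forall t, 0 <= t <= T -> D t = 0}.
Proof.
move=> iD D0.
pose f := D \_ `[0, T].
have mT : measurable (`[0, T] : set R) by [].
have iT : mu.-integrable setT (EFin \o f).
  by rewrite -restrict_EFin; apply/integrable_restrict => //=; rewrite setTI.
have F1 : forall y, mu.-integrable [set` Interval (BLeft (0:R)) (BRight y)] (EFin \o f).
  by move=> y; apply: integrableS iT.
have lf : locally_integrable [set: R] f.
  apply: open_integrable_locally => //; exact: openT.
have F0 : forall x, (\int[mu]_(t in `[0, x]) f t)%R = 0.
  move=> x; rewrite /f -Rintegral_mkcondr/=.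
  have [x0|x0] := ltP x 0.
    rewrite set_itv_ge ?set0I ?Rintegral_set0//.
    by rewrite bnd_simp -ltNge.
  have [xT|Tx] := leP x T.
    rewrite setIidl ?D0 ?x0//.
    by apply: subset_itvl; rewrite bnd_simp.
  rewrite setIidr; last by apply: subset_itvl; rewrite bnd_simp ltW.
  have [T0|T0] := ltP T 0; last by apply: D0; rewrite T0 /=.
  by rewrite set_itv_ge ?Rintegral_set0// bnd_simp -ltNge.
have H0 := FTC1 F1 lf.
have n0 : {ae mu, forall t : R, t != 0}.
  exists [set 0]; split => //; first by rewrite lebesgue_measure_set1.
  by move=> t /= /negP; rewrite negbK => /eqP.
move: H0; apply: (@filterS2 _ _ (ae_filter_ringOfSetsType mu) _ _ _ _ n0).
move=> t t0 H tT.
case: H; first by rewrite lte_fin lt_neqAle eq_sym t0; case/andP: tT.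
move=> _.
rewrite (_ : (fun x => _) = (fun=> 0 : R)); last by apply/funext => x; exact: F0.
by rewrite derive1_cst /f patchE mem_set//= in_itv.
Qed.

Lemma integrableM_continuous (T : R) (a g : R -> R) :
  mu.-integrable `[0, T] (EFin \o a) -> {within `[0, T], continuous g} ->
  mu.-integrable `[0, T] (EFin \o (fun s => a s * g s)).
Proof.
move=> ia cg.
have cT : compact (`[0, T] : set R) by exact: segment_compact.
have := @integrableMl _ _ R mu `[0, T] _ (EFin \o a) g ia.
rewrite (_ : ((EFin \o a) \* (EFin \o g))%E = EFin \o (fun s => a s * g s)).
  apply => //.
    by apply: subspace_continuous_measurable_fun.
  have /compact_bounded[M [_ mrt]] := continuous_compact cg cT.
  by exists M; split; rewrite ?num_real // => ? ? ? ?; exact: mrt.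
by apply/funext => s /=; rewrite EFinM.
Qed.

(** Integrands are only integrable, so the classical integration by parts does
    not apply.  Instead, the integral of [a x * b y] over the triangle
    [x <= y] of the square is computed in both orders by Fubini. *)
Lemma Rintegral_by_parts (t : R) (a b : R -> R) : 0 <= t ->
  mu.-integrable `[0, t] (EFin \o a) -> mu.-integrable `[0, t] (EFin \o b) ->
  let F x := \int[mu]_(s in `[0, x]) a s in
  let G x := \int[mu]_(s in `[0, x]) b s in
  F t * G t = \int[mu]_(s in `[0, t]) (a s * G s + F s * b s).
Proof.
move=> t0 ia ib F G.
have mab (f : R -> R) : mu.-integrable `[0, t] (EFin \o f) ->
    mu.-integrable setT (EFin \o (f \_ `[0, t])).
  move=> i; rewrite -restrict_EFin; apply/integrable_restrict => //=.
  by rewrite setTI.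
pose a' : R -> R := a \_ `[0, t]; pose b' : R -> R := b \_ `[0, t].
have ia' : mu.-integrable setT (EFin \o a') by exact: mab.
have ib' : mu.-integrable setT (EFin \o b') by exact: mab.
have ma' : measurable_fun setT a' by exact: measurable_integrand ia'.
have mb' : measurable_fun setT b' by exact: measurable_integrand ib'.
pose k (z : R * R) : R := if z.1 <= z.2 then a' z.1 * b' z.2 else 0.
have mk : measurable_fun setT (EFin \o k).
  apply/measurable_EFinP; apply: measurable_fun_ifT.
  - exact: measurable_fun_ler.
  - by apply: measurable_funM; apply: measurableT_comp.
  - exact: measurable_cst.
have mg : measurable_fun [set: R * R] (fun z => (a' z.1 * b' z.2)%:E).
  by apply/measurable_EFinP; apply: measurable_funM; apply: measurableT_comp.
have ig : (mu \x mu)%E.-integrable setT (fun z : R * R => (a' z.1 * b' z.2)%:E).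
  apply: (@integrable12ltyP _ _ _ _ R mu mu _ mg).2 => /=.
  have B x : (\int[mu]_y `|(a' x * b' y)%:E| = `|a' x|%:E * \int[mu]_y `|(b' y)%:E|)%E.
    rewrite -ge0_integralZl//; last exact/measurable_EFinP/measurableT_comp.
    by apply: eq_integral => y _; rewrite EFinM abseM.
  under eq_integral do rewrite B.
  case/integrableP : ia' => _ la; case/integrableP : ib' => _ lb.
  rewrite ge0_integralZr//.
  - by apply: lte_mul_pinfty => //; [exact: integral_ge0|];
    rewrite ge0_fin_numE//; exact: integral_ge0.
  - exact/measurable_EFinP/measurableT_comp.
  - exact: integral_ge0.
have ik : (mu \x mu)%E.-integrable setT (EFin \o k).
  apply: (@le_integrable _ _ _ (mu \x mu)%E setT _ _ _ mk _ ig) => //.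
  by move=> z _ /=; rewrite lee_fin /k; case: ifP => // _; rewrite normr0.
(* [G'] and [F'] are the inner integrals over the triangle, without the factor
   that depends on the outer variable. *)
have cut (f : R -> R) (p : R -> bool) : mu.-integrable setT (EFin \o f) ->
    measurable_fun setT p ->
    mu.-integrable setT (EFin \o (fun y => if p y then f y else 0)).
  move=> intf mp; apply: (@le_integrable _ _ R mu setT _ _ (EFin \o f)) => //.
    apply/measurable_EFinP; apply: measurable_fun_ifT => //.
    exact: measurable_integrand.
  by move=> y _ /=; rewrite lee_fin; case: ifP => // _; rewrite normr0.
have Zint (c : R) (f : R -> R) : mu.-integrable setT (EFin \o f) ->
    (\int[mu]_y (c * f y)%:E = (c * \int[mu]_y f y)%:E)%E.
  move=> intf; rewrite EFinM fineK; last exact: integrable_fin_num.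
  by rewrite -integralZl.
have ib'x x : mu.-integrable setT (EFin \o (fun y => if x <= y then b' y else 0)).
  by apply: cut => //; exact: measurable_fun_ler.
have ia'y y : mu.-integrable setT (EFin \o (fun x => if x <= y then a' x else 0)).
  by apply: cut => //; exact: measurable_fun_ler.
pose G' x := \int[mu]_y (if x <= y then b' y else 0).
pose F' y := \int[mu]_x (if x <= y then a' x else 0).
have F1 : \int[mu]_x (a' x * G' x) = \int[mu]_y (b' y * F' y).
  have Kx x : (\int[mu]_y (EFin \o k) (x, y) = (a' x * G' x)%:E)%E.
    rewrite -Zint//; apply: eq_integral => y _; rewrite /k /=.
    by case: ifP => //; rewrite mulr0.
  have Ky y : (\int[mu]_x (EFin \o k) (x, y) = (b' y * F' y)%:E)%E.
    rewrite -Zint//; apply: eq_integral => x _; rewrite /k /=.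
    by case: ifP; rewrite ?mulr0// mulrC.
  rewrite /Rintegral; congr fine.
  transitivity (\int[mu]_x \int[mu]_y (EFin \o k) (x, y))%E.
    by apply: eq_integral => x _; rewrite Kx.
  transitivity (\int[mu]_y \int[mu]_x (EFin \o k) (x, y))%E; first exact: Fubini ik.
  by apply: eq_integral => y _; rewrite Ky.
have G'E x : x \in `[0, t] -> G' x = G t - G x.
  rewrite in_itv/= => /andP[x0 xt].
  rewrite /G Rintegral_itvB ?bnd_simp// Rintegral_itv_obnd_cbnd; last first.
    by apply: integrableS ib => //; apply: subset_itv; rewrite bnd_simp.
  rewrite [RHS]Rintegral_mkcond /G'; congr Rintegral; apply/funext => y.
  rewrite /b' /patch !mem_setE !in_itv/=.
  by case: (leP x y) => //= xy; rewrite (le_trans x0 xy).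
have F'E y : y \in `[0, t] -> F' y = F y.
  rewrite in_itv/= => /andP[y0 yt].
  rewrite /F [RHS]Rintegral_mkcond /F'; congr Rintegral; apply/funext => x.
  rewrite /a' /patch !mem_setE !in_itv/=.
  case: (leP x y) => //= xy; last by rewrite andbF.
  by rewrite (le_trans xy yt).
have {F1} : \int[mu]_(x in `[0, t]) (a x * (G t - G x)) =
    \int[mu]_(x in `[0, t]) (b x * F x).
  rewrite Rintegral_mkcond [RHS]Rintegral_mkcond.
  transitivity (\int[mu]_x (a' x * G' x)).
    congr Rintegral; apply/funext => x; rewrite /a' /patch.
    case: ifP; last by rewrite mul0r.
    by rewrite inE => /G'E ->.
  rewrite F1; congr Rintegral; apply/funext => x; rewrite /b' /patch.
  case: ifP; last by rewrite mul0r.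
  by rewrite inE => /F'E ->.
have cF := parameterized_integral_continuous t0 ia.
have cG := parameterized_integral_continuous t0 ib.
have iaG := integrableM_continuous ia cG.
have ibF := integrableM_continuous ib cF.
under eq_Rintegral do rewrite mulrBr.
rewrite RintegralB//; last first.
  rewrite (_ : _ \o _ = (fun y => (G t)%:E * (EFin \o a) y)%E).
    exact: integrableZl.
  by apply/funext => y /=; rewrite mulrC.
rewrite RintegralZr// -/(F t) => /eqP; rewrite subr_eq => /eqP ->.
under [in RHS]eq_Rintegral do rewrite (mulrC (F _)).
rewrite [RHS]RintegralD; [by rewrite addrC|by []|exact: iaG|by []].
Qed.

Lemma differential_dt_continuous (T : R) (X b : R -> R) : 0 <= T ->
  differential_dt T X b -> {within `[0, T], continuous X}.
Proof.
move=> T0 [ib Xb].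
pose Y t := X 0 + parameterized_integral mu 0 t b.
have XY : {in `[0, T]%classic, Y =1 X}.
  by move=> t; rewrite inE/= in_itv/= => /Xb ->.
apply: (subspace_eq_continuous XY) => t.
apply: cvgD; first exact: cvg_cst.
exact: (parameterized_integral_continuous T0 ib).
Qed.

Lemma differential_dt_ext (T : R) (X Y b : R -> R) : 0 <= T ->
  (forall t, 0 <= t <= T -> X t = Y t) ->
  differential_dt T X b -> differential_dt T Y b.
Proof.
move=> T0 XY [ib Xb]; split => // t tT.
by rewrite -!XY ?lexx// Xb.
Qed.

(** Integrability of the new drift needs its Borel measurability as a separate
    hypothesis: almost everywhere equality does not transport it. *)
Lemma differential_dt_ae (T : R) (X b c : R -> R) :
  differential_dt T X b -> measurable_fun `[0, T] c ->
  {ae mu, forall t, 0 <= t <= T -> b t = c t} -> differential_dt T X c.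
Proof.
move=> [ib Xb] mc bc.
have mEc : measurable_fun `[0, T] (EFin \o c) by exact/measurable_EFinP.
have ic : mu.-integrable `[0, T] (EFin \o c).
  have ibT := measurable_int mu ib.
  case/integrableP : ib => mb bfin; apply/integrableP; split => //.
  rewrite (_ : (\int[mu]_(x in `[0%R, T]) `|(EFin \o c) x|)%E =
    (\int[mu]_(x in `[0%R, T]) `|(EFin \o b) x|)%E) //.
  apply: ae_eq_integral => //; [exact: measurableT_comp..|].
  apply: filterS bc; first exact: (ae_filter_ringOfSetsType mu).
  by move=> t h; rewrite /= in_itv/= => /h ->.
split => // t tT; rewrite Xb//; congr (_ + _).
have /andP[_ tleT] := tT.
rewrite /Rintegral; congr fine.
apply: ae_eq_integral => //.
- exact: measurable_int (integrable_itv0 tleT ib).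
- exact: measurable_int (integrable_itv0 tleT ic).
- apply: filterS bc; first exact: (ae_filter_ringOfSetsType mu).
  move=> s h; rewrite /= in_itv/= => /andP[s0 st]; rewrite h// s0/=.
  exact: le_trans st tleT.
Qed.

Lemma differential_dt_cst (T : R) (c : R) : differential_dt T (fun=> c) (fun=> 0).
Proof.
split; first exact: (@integrable0 _ _ R mu).
by move=> t _; rewrite Rintegral_cst// mul0r addr0.
Qed.

Lemma differential_dtD (T : R) (X b Y c : R -> R) :
  differential_dt T X b -> differential_dt T Y c ->
  differential_dt T (fun t => X t + Y t) (fun t => b t + c t).
Proof.
move=> [ib Xb] [ic Yc]; split.
  by have := integrableD _ ib ic; apply.
move=> t tT; have /andP[_ tleT] := tT.
rewrite RintegralD//; [|exact: integrable_itv0 ib|exact: integrable_itv0 ic].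
by rewrite Xb// Yc// addrACA.
Qed.

Lemma differential_dtZ (T : R) (k : R) (X b : R -> R) :
  differential_dt T X b ->
  differential_dt T (fun t => k * X t) (fun t => k * b t).
Proof.
move=> [ib Xb]; split.
  rewrite (_ : _ \o _ = (fun y => k%:E * (EFin \o b) y)%E) //.
  exact: integrableZl.
move=> t tT; have /andP[_ tleT] := tT.
by rewrite RintegralZl//; [rewrite Xb// mulrDr|exact: integrable_itv0 ib].
Qed.

Lemma differential_dt_sum (T : R) (I : Type) (r : seq I) (X b : I -> R -> R) :
  (forall i, differential_dt T (X i) (b i)) ->
  differential_dt T (fun t => \sum_(i <- r) X i t) (fun t => \sum_(i <- r) b i t).
Proof.
move=> Xb; elim: r => [|i r IH].
  have := differential_dt_cst T 0; congr differential_dt;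
  by apply/funext => t; rewrite big_nil.
have := differential_dtD (Xb i) IH; congr differential_dt;
  by apply/funext => t; rewrite big_cons.
Qed.

Lemma differential_dtM (T : R) (X b Y c : R -> R) : 0 <= T ->
  differential_dt T X b -> differential_dt T Y c ->
  differential_dt T (fun t => X t * Y t) (fun t => b t * Y t + X t * c t).
Proof.
move=> T0 Xb Yc.
have cX := differential_dt_continuous T0 Xb.
have cY := differential_dt_continuous T0 Yc.
case: Xb => ib Xb; case: Yc => ic Yc.
have iY := integrableM_continuous ib cY.
have iX := integrableM_continuous ic cX.
have iX' : mu.-integrable `[0, T] (EFin \o (fun s => X s * c s)).
  by move: iX; congr (_.-integrable _ _); apply/funext => s /=; rewrite mulrC.
split; first by have := integrableD _ iY iX'; apply.
move=> t /andP[t0 tT].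
have ibt := integrable_itv0 tT ib; have ict := integrable_itv0 tT ic.
pose F x : R := \int[mu]_(s in `[0, x]) b s.
pose G x : R := \int[mu]_(s in `[0, x]) c s.
have FG : F t * G t = \int[mu]_(s in `[0, t]) (b s * G s + F s * c s).
  exact: Rintegral_by_parts.
have XF s : s \in (`[0, t]%classic : set R) -> X s = X 0 + F s.
  rewrite inE/= in_itv/= => /andP[s0 st]; apply: Xb.
  by rewrite s0 (le_trans st).
have YG s : s \in (`[0, t]%classic : set R) -> Y s = Y 0 + G s.
  rewrite inE/= in_itv/= => /andP[s0 st]; apply: Yc.
  by rewrite s0 (le_trans st).
have tt : t \in (`[0, t]%classic : set R) by rewrite inE/= in_itv/= lexx t0.
have cF := parameterized_integral_continuous t0 ibt.
have cG := parameterized_integral_continuous t0 ict.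
have ibG := integrableM_continuous ibt cG.
have icF := integrableM_continuous ict cF.
have -> : \int[mu]_(s in `[0, t]) (b s * Y s + X s * c s) =
    \int[mu]_(s in `[0, t]) ((b s * G s + F s * c s) + (b s * Y 0 + c s * X 0)).
  apply: eq_Rintegral => s st; rewrite (XF _ st) (YG _ st).
  by ring.
have iMZ (f : R -> R) (r : R) : mu.-integrable `[0, t] (EFin \o f) ->
    mu.-integrable `[0, t] (EFin \o (fun s => f s * r)).
  move=> intf; rewrite (_ : _ \o _ = (fun y => r%:E * (EFin \o f) y)%E).
    exact: integrableZl.
  by apply/funext => y /=; rewrite mulrC.
have iAdd (f g : R -> R) : mu.-integrable `[0, t] (EFin \o f) ->
    mu.-integrable `[0, t] (EFin \o g) ->
    mu.-integrable `[0, t] (EFin \o (fun s => f s + g s)).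
  by move=> h1 h2; have := integrableD _ h1 h2; apply.
have icF' : mu.-integrable `[0, t] (EFin \o (fun s => F s * c s)).
  by move: icF; congr (_.-integrable _ _); apply/funext => s /=; rewrite mulrC.
rewrite RintegralD//; [|exact: iAdd|by apply: iAdd; exact: iMZ].
rewrite -FG RintegralD//; [|exact: iMZ..].
rewrite RintegralZr// RintegralZr// -/(F t) -/(G t) (XF _ tt) (YG _ tt).
by ring.
Qed.

End Calculus.

(** * Polynomials and their moments on an interval *)

Section PolyIntegral.
Context {R : realType}.
Notation mu := (@lebesgue_measure R).
Implicit Types (p q : {poly R}) (a b : R).

Definition poly_int a b p : R := \int[mu]_(y in `[a, b]) p.[y].

Lemma integrable_horner a b p : mu.-integrable `[a, b] (EFin \o horner p).
Proof.
apply: continuous_compact_integrable; first exact: segment_compact.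
by apply: continuous_subspaceT => y; exact: continuous_horner.
Qed.

Lemma poly_int_is_linear a b : linear (poly_int a b).
Proof.
move=> c p q; rewrite /poly_int.
under eq_Rintegral do rewrite hornerD hornerZ.
have ip := integrable_horner a b p; have iq := integrable_horner a b q.
rewrite RintegralD//; first by rewrite RintegralZl.
have := integrable_horner a b (c *: p); congr (_.-integrable _ _).
by apply/funext => y /=; rewrite hornerZ.
Qed.

HB.instance Definition _ a b :=
  GRing.isLinear.Build R {poly R} R _ (poly_int a b) (poly_int_is_linear a b).

Lemma poly_int_deriv a b p : a < b -> poly_int a b p^`() = p.[b] - p.[a].
Proof.
move=> ab; rewrite /poly_int /Rintegral (@continuous_FTC2 _ _ (horner p))//.
- by apply: continuous_subspaceT => y; exact: continuous_horner.
- split.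
  + by move=> y _; exact: derivable_horner.
  + by apply: cvg_at_right_filter; exact: continuous_horner.
  + by apply: cvg_at_left_filter; exact: continuous_horner.
- by move=> y _; rewrite derivE.
Qed.

Lemma Rintegral_eq_poly_int a b p (f : R -> R) :
  (forall y, a < y < b -> f y = p.[y]) ->
  \int[mu]_(y in `[a, b]) f y = poly_int a b p.
Proof.
move=> fp; rewrite /poly_int /Rintegral; congr fine.
have mp : measurable_fun `]a, b[ (horner p).
  apply: measurable_funTS; apply: continuous_measurable_fun => y.
  exact: continuous_horner.
apply: eq_integral_itv_bounded => //.
apply: eq_measurable_fun mp => y; rewrite inE/= in_itv/= => yab.
by rewrite fp.
Qed.

Lemma finite_roots p : p != 0 -> finite_set [set y | root p y].
Proof.
move=> p0; apply: contrapT => /(infinite_set_fset (size p))[B Bp].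
rewrite leqNgt => /negP; apply.
apply: max_poly_roots => //; last exact: finmap.fset_uniq.
by apply/allP => y yB; exact: Bp.
Qed.

(** A square with zero integral vanishes almost everywhere, whereas a nonzero
    polynomial has a finite, hence null, set of roots. *)
Lemma poly_int_sqr_eq0 a b p : a < b -> poly_int a b (p * p) = 0 -> p = 0.
Proof.
move=> ab i0; have [//|p0] := eqVneq p 0; exfalso.
have mq : measurable_fun `[a, b] (EFin \o horner (p * p)).
  exact: measurable_int (integrable_horner a b (p * p)).
have : (\int[mu]_(y in `[a, b]) `|(EFin \o horner (p * p)) y|)%E = 0%E.
  transitivity (poly_int a b (p * p))%:E; last by rewrite i0.
  rewrite fineK; last first.
    by apply: integrable_fin_num => //; exact: integrable_horner.
  by apply: eq_integral => y _ /=; rewrite hornerM ger0_norm// -expr2 sqr_ge0.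
move=> h0.
have [] := (ae_eq_integral_abs mu (@measurable_itv _ _) mq).1 h0.
move=> N [mN N0 HN].
have cr : countable [set y | root p y].
  exact/finite_set_countable/finite_roots.
have mr : measurable ([set y | root p y] : set R) by exact: countable_measurable.
have muab : mu [set` `[a, b]] = (b - a)%:E.
  by rewrite lebesgue_measure_itv/= lte_fin ab -EFinD.
have : ((b - a)%:E <= mu N + mu [set y | root p y])%E.
  rewrite -muab; apply: (@le_trans _ _ (mu (N `|` [set y | root p y]))); last exact: measureU2.
  apply: le_measure; rewrite ?inE//; first exact: measurableU.
  move=> y yab; have [py|py] := boolP (root p y); first by right.
  left; apply: HN => /= /(_ yab) [] /eqP.
  by rewrite hornerM mulf_eq0 orbb; apply/negP.
rewrite N0 countable_lebesgue_measure0//.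
rewrite add0e lee_fin.
by rewrite leNgt subr_gt0 ab.
Qed.

Section Gram.
Variable d : nat.

Definition gram a b : 'M[R]_d := \matrix_(i, j) poly_int a b ('X^i * 'X^j).

Definition moments a b p : 'rV[R]_d := \row_j poly_int a b (p * 'X^j).

Lemma rVpoly_sum (v : 'rV[R]_d) : rVpoly v = \sum_i v 0 i *: 'X^i.
Proof.
rewrite {1}(row_sum_delta v) linear_sum; apply: eq_bigr => i _.
by rewrite linearZ/= rVpoly_delta.
Qed.

Lemma moments_rVpoly a b v : moments a b (rVpoly v) = v *m gram a b.
Proof.
apply/rowP => j; rewrite !mxE rVpoly_sum mulr_suml linear_sum.
by apply: eq_bigr => i _; rewrite mxE -scalerAl linearZ.
Qed.

Lemma tr_gram a b : (gram a b)^T = gram a b.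
Proof. by apply/matrixP => i j; rewrite !mxE mulrC. Qed.

(** A kernel vector is the coefficient vector of a polynomial orthogonal to all
    monomials of its degree, hence to itself. *)
Lemma gram_unitmx a b : a < b -> gram a b \in unitmx.
Proof.
move=> ab; rewrite unitmxE unitfE; apply/negP => /det0P[v v0].
rewrite -moments_rVpoly => /rowP v1; move/eqP: v0; apply.
apply: (can_inj (@rVpolyK _ _)); rewrite linear0.
apply: (poly_int_sqr_eq0 ab).
rewrite {2}rVpoly_sum mulr_sumr linear_sum big1// => i _.
by rewrite -scalerAr linearZ/=; have := v1 i; rewrite !mxE => ->; rewrite scaler0.
Qed.

Lemma poly_of_moments a b p : a < b -> (size p <= d)%N ->
  p = rVpoly (moments a b p *m invmx (gram a b)).
Proof.
move=> ab sp; rewrite -{2}(poly_rV_K sp) moments_rVpoly mulmxK ?gram_unitmx//.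
by rewrite poly_rV_K.
Qed.

End Gram.
End PolyIntegral.

(** * The matrices of the system *)

Section Matrices.
Context {R : realType}.
Implicit Types (a b c : 'cV[R]_6) (B : 'M[R]_6).

Lemma dotE a b : dot a b = (a^T *m b) 0 0.
Proof. by rewrite mxE; apply: eq_bigr => i _; rewrite mxE. Qed.

Lemma dotC a b : dot a b = dot b a.
Proof. by apply: eq_bigr => i _; rewrite mulrC. Qed.

Lemma dotDl a b c : dot (a + b) c = dot a c + dot b c.
Proof. by rewrite /dot -big_split; apply: eq_bigr => i _; rewrite mxE mulrDl. Qed.

Lemma dotZl (k : R) a c : dot (k *: a) c = k * dot a c.
Proof. by rewrite /dot mulr_sumr; apply: eq_bigr => i _; rewrite mxE mulrA. Qed.

Lemma dotNl a c : dot (- a) c = - dot a c.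
Proof. by rewrite -scaleN1r dotZl mulN1r. Qed.

Lemma dotDr a b c : dot a (b + c) = dot a b + dot a c.
Proof. by rewrite dotC dotDl (dotC b) (dotC c). Qed.

Lemma dotZr (k : R) a c : dot a (k *: c) = k * dot a c.
Proof. by rewrite dotC dotZl dotC. Qed.

Lemma dot_tr B a b : dot (B *m a) b = dot (B^T *m b) a.
Proof.
by rewrite dotC !dotE trmx_mul trmxK mulmxA.
Qed.

Lemma dot_antisym B a b : B^T = - B -> dot (B *m a) b = - dot (B *m b) a.
Proof. by move=> BN; rewrite dot_tr BN mulNmx dotNl. Qed.

Lemma dot_sym B a b : B^T = B -> dot (B *m a) b = dot (B *m b) a.
Proof. by move=> BS; rewrite dot_tr BS. Qed.

Lemma tr_Kmat : (@Kmat R)^T = - Kmat.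
Proof.
apply/matrixP => i j; rewrite !mxE.
by case: i j => [[|[|[|[|[|[|i]]]]]] ilt] [[|[|[|[|[|[|j]]]]]] jlt] //=; rewrite ?opprK ?oppr0.
Qed.

Lemma tr_Mmat : (@Mmat R)^T = - Mmat.
Proof.
apply/matrixP => i j; rewrite !mxE.
by case: i j => [[|[|[|[|[|[|i]]]]]] ilt] [[|[|[|[|[|[|j]]]]]] jlt] //=; rewrite ?opprK ?oppr0.
Qed.

Lemma tr_Amat (m n : R) : (Amat m n)^T = Amat m n.
Proof.
apply/matrixP => i j; rewrite !mxE.
by case: i j => [[|[|[|[|[|[|i]]]]]] ilt] [[|[|[|[|[|[|j]]]]]] jlt].
Qed.

(** On the last four components [M] is a complex structure; the first two
    components span its kernel. *)
Lemma Mmat_sqr : Mmat *m Mmat =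
  \matrix_(i, j) (if (i == j) && (1 < i)%N then -1 else 0) :> 'M[R]_6.
Proof.
apply/matrixP => i j; rewrite !mxE !big_ord_recl big_ord0 !mxE/=.
case: i j => [[|[|[|[|[|[|i]]]]]] ilt] [[|[|[|[|[|[|j]]]]]] jlt] //=;
 rewrite ?(mul0r, mulr0, addr0, add0r, mulr1, mul1r, mulN1r) //.
Qed.

(** The [u] and [eta] rows of the scheme contain [u] and [eta] only through the
    Hessian, where they appear with coefficient [-1]. *)
Lemma Kmat_upper (i s : 'I_6) : (i < 2)%N -> (s < 2)%N -> Kmat i s = 0 :> R.
Proof. by rewrite mxE; case: i s => [[|[|i]] ?] [[|[|s]] ?]. Qed.

Lemma Amat_upper (m n : R) (i s : 'I_6) : (i < 2)%N -> (s < 2)%N -> Amat m n i s = 0.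
Proof. by rewrite mxE; case: i s => [[|[|i]] ?] [[|[|s]] ?]. Qed.

Lemma Mmat_upper (i s : 'I_6) : (i < 2)%N -> Mmat i s = 0 :> R.
Proof. by rewrite mxE; case: i s => [[|[|i]] ?] [[|[|s]] ?]. Qed.

(** The difference quotient of a function that is quadratic along a line is
    affine in the increment. *)
Lemma derive_quadratic (V : normedModType R) (f : V -> R) (v y : V) (L c : R) :
  (forall h, f (h *: v + y) = f y + h * L + h ^+ 2 * c) -> 'D_v f y = L.
Proof.
move=> fh; apply/cvg_lim; first exact: Rhausdorff.
apply: (@cvg_trans _ ((fun h : R => L + h * c) @ 0^')).
  apply: near_eq_cvg; near=> h.
  have h0 : h != 0 by near: h; exact: nbhs_dnbhs_neq.
  by rewrite /= fh /GRing.scale/=; field.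
suff : (fun h : R => L + h * c) @ 0^' --> L + 0 * c by rewrite mul0r addr0.
apply: cvgD; first exact: cvg_cst.
apply: cvgMr_tmp; exact: nbhs_dnbhs.
Unshelve. all: by end_near. Qed.

(** The polarization of the quadratic form [S1]. *)
Definition S1form (y v : 'cV[R]_6) : R :=
  let c k (z : 'cV[R]_6) := z (inord k) 0 in
  c 4%N y * c 0%N v + c 4%N v * c 0%N y + c 5%N y * c 1%N v + c 5%N v * c 1%N y
  - c 0%N y * c 0%N v - c 1%N y * c 1%N v.

Lemma derive_S1 (v y : 'cV[R]_6) : 'D_v S1 y = S1form y v.
Proof.
apply: (@derive_quadratic _ _ _ _ _ (S1 v)) => h.
by rewrite /S1 /S1form !mxE; field.
Qed.

Lemma hessS1E (i s : 'I_6) :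
  hessS1 i s = S1form (delta_mx i 0) (delta_mx s 0) :> R.
Proof.
rewrite mxE (_ : (fun y => _) = S1form ^~ (delta_mx s 0)); last first.
  by apply/funext => y; exact: derive_S1.
apply: (@derive_quadratic _ _ _ _ _ 0) => h.
by rewrite /S1form !mxE; ring.
Qed.

Lemma tr_hessS1 : (@hessS1 R)^T = hessS1.
Proof.
by apply/matrixP => i j; rewrite mxE !hessS1E /S1form; ring.
Qed.

Lemma hessS1_upper (i s : 'I_6) : (i < 2)%N -> (s < 2)%N ->
  hessS1 i s = - (i == s)%:R :> R.
Proof.
rewrite hessS1E /S1form !mxE.
case: i s => [[|[|i]] ?] [[|[|s]] ?] // _ _; rewrite -!val_eqE /= !inordK//=; by ring.
Qed.

End Matrices.

(** * The weak form on piecewise polynomials *)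

Section PiecewisePolynomials.
Context {R : realType}.
Variables (N : nat) (xs : nat -> R).
Hypothesis hxs : is_mesh N xs.
Variables (m n : R).
Notation mu := (@lebesgue_measure R).
Implicit Types (q : 'I_6 -> {poly R}) (u v : nat -> 'I_6 -> {poly R}).
Implicit Types (Z U V : R -> 'cV[R]_6).

Definition eval_field q (y : R) : 'cV[R]_6 := \col_i (q i).[y].

Lemma continuous_eval_field q : continuous (eval_field q).
Proof.
have -> : eval_field q = fun y => \sum_(i < 6) (q i).[y] *: delta_mx i 0.
  apply/funext => y; apply/colP => i; rewrite mxE summxE (bigD1 i)//= big1.
    by rewrite !mxE !eqxx mulr1 addr0.
  by move=> s si; rewrite !mxE eq_sym (negbTE si) mulr0.
apply: continuous_big => [|i _ y]; first exact: add_continuous.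
by apply: cvgZr_tmp; exact: continuous_horner.
Qed.

(** Values on the interfaces are left free, as they are in the space [Vh];
    traces and integrals depend on the pieces alone. *)
Definition represents u Z := forall l, (l < N)%N ->
  forall y, xs l < y < xs l.+1 -> Z y = eval_field (u l) y.

(** With periodicity, interface [0] is preceded by the last cell and interface
    [N] is followed by the first one. *)
Definition left_cell j := (if j == 0%N then N else j).-1.
Definition right_cell j := if j == N then 0%N else j.

Definition left_trace u j := eval_field (u (left_cell j)) (xs (left_cell j).+1).
Definition right_trace u j := eval_field (u (right_cell j)) (xs (right_cell j)).

Lemma left_cellS j : left_cell j.+1 = j. Proof. by []. Qed.

Lemma right_cell_lt j : (j < N)%N -> right_cell j = j.
Proof. by rewrite /right_cell; case: eqP => // ->; rewrite ltnn. Qed.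

Lemma left_cell_ltn j : (0 < N)%N -> (j <= N)%N -> (left_cell j < N)%N.
Proof. by case: j => [|j]; rewrite /left_cell/=; [case: (N)|]. Qed.

Lemma right_cell_ltn j : (0 < N)%N -> (j <= N)%N -> (right_cell j < N)%N.
Proof. by rewrite /right_cell; case: eqP => // /eqP jN N0; rewrite ltn_neqAle jN. Qed.

Lemma tr_left_pieces (W : normedModType R) (f : R -> W) (g : nat -> R -> W) j :
  (0 < N)%N -> (j <= N)%N ->
  (forall l, (l < N)%N -> forall y, xs l < y < xs l.+1 -> f y = g l y) ->
  (forall l, continuous (g l)) ->
  tr_left N xs f j = g (left_cell j) (xs (left_cell j).+1).
Proof.
move=> N0 jN fg cg; have lN := left_cell_ltn N0 jN.
rewrite /tr_left (_ : (if j == 0%N then N else j) = (left_cell j).+1); last first.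
  by rewrite /left_cell; case: (j) => [|i] //=; rewrite prednK.
set l := left_cell j; apply/cvg_lim; first exact: norm_hausdorff.
apply: (@cvg_trans _ (g l y @[y --> (xs l.+1)^'-])).
  apply: near_eq_cvg; near=> y; rewrite (fg l)//; apply/andP; split; near: y.
    by apply: nbhs_left_gt; exact: hxs.
  exact: nbhs_left_lt.
by apply: cvg_at_left_filter; exact: cg.
Unshelve. all: by end_near. Qed.

Lemma tr_right_pieces (W : normedModType R) (f : R -> W) (g : nat -> R -> W) j :
  (0 < N)%N -> (j <= N)%N ->
  (forall l, (l < N)%N -> forall y, xs l < y < xs l.+1 -> f y = g l y) ->
  (forall l, continuous (g l)) ->
  tr_right N xs f j = g (right_cell j) (xs (right_cell j)).
Proof.
move=> N0 jN fg cg; have lN := right_cell_ltn N0 jN.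
rewrite /tr_right -/(right_cell j).
set l := right_cell j; apply/cvg_lim; first exact: norm_hausdorff.
apply: (@cvg_trans _ (g l y @[y --> (xs l)^'+])).
  apply: near_eq_cvg; near=> y; rewrite (fg l)//; apply/andP; split; near: y.
    exact: nbhs_right_gt.
  by apply: nbhs_right_lt; exact: hxs.
by apply: cvg_at_right_filter; exact: cg.
Unshelve. all: by end_near. Qed.

Definition flux u j : 'cV[R]_6 :=
  Kmat *m (2^-1 *: (right_trace u j + left_trace u j)) +
  Amat m n *m (right_trace u j - left_trace u j).

Lemma KfluxE u Z j : (0 < N)%N -> (j <= N)%N -> represents u Z ->
  Kflux N xs m n Z j = flux u j.
Proof.
move=> N0 jN uZ; rewrite /Kflux /avg /jump.
rewrite (tr_left_pieces N0 jN uZ) ?(tr_right_pieces N0 jN uZ)// => l;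
  exact: continuous_eval_field.
Qed.

(** The integrand [BU.V] as a polynomial, so that it can be differentiated
    formally. *)
Definition dotp (B : 'M[R]_6) q q' : {poly R} :=
  \sum_i (\sum_s B i s *: q s) * q' i.

Lemma horner_dotp B q q' y :
  (dotp B q q').[y] = dot (B *m eval_field q y) (eval_field q' y).
Proof.
rewrite /dotp horner_sum; apply: eq_bigr => i _.
rewrite hornerM horner_sum !mxE; congr (_ * _).
by apply: eq_bigr => s _; rewrite hornerZ mxE.
Qed.

Definition FK_pieces u v j : R :=
  2^-1 * (dot (Kmat *m right_trace u j) (right_trace v j)
          + dot (Kmat *m left_trace u j) (left_trace v j))
  - dot (flux u j) (2^-1 *: (right_trace v j + left_trace v j))
  + dot (flux v j) (2^-1 *: (right_trace u j + left_trace u j)).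

Lemma FK_of_pieces u v U V j : (0 < N)%N -> (j <= N)%N ->
  represents u U -> represents v V ->
  FK N xs m n U V j = FK_pieces u v j.
Proof.
move=> N0 jN uU vV; rewrite /FK (KfluxE N0 jN uU) (KfluxE N0 jN vV) /avg.
have cev w l : continuous (eval_field (w l)) by exact: continuous_eval_field.
rewrite (tr_left_pieces N0 jN uU)// (tr_right_pieces N0 jN uU)//.
rewrite (tr_left_pieces N0 jN vV)// (tr_right_pieces N0 jN vV)//.
have kuv l : (l < N)%N -> forall y, xs l < y < xs l.+1 ->
    dot (Kmat *m U y) (V y) = (dotp Kmat (u l) (v l)).[y].
  by move=> lN y ly; rewrite horner_dotp (uU l)// (vV l).
have ck l : continuous (horner (dotp Kmat (u l) (v l))) by exact: continuous_horner.
by rewrite (tr_left_pieces N0 jN kuv)// (tr_right_pieces N0 jN kuv)// !horner_dotp.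
Qed.

(** One row of the weak form in polynomial terms; being linear in [p], it gives
    the drift for every test function from its values on monomials. *)
Definition drift u j (i : 'I_6) (p : {poly R}) : R :=
  poly_int (xs j) (xs j.+1) ((\sum_s Kmat i s *: u j s) * p^`())
  - flux u j.+1 i 0 * p.[xs j.+1] + flux u j i 0 * p.[xs j]
  + poly_int (xs j) (xs j.+1) ((\sum_s hessS1 i s *: u j s) * p).

Definition component_test (i : 'I_6) (p : {poly R}) (y : R) : 'cV[R]_6 :=
  p.[y] *: delta_mx i 0.

Lemma dot_delta (a : 'cV[R]_6) (i : 'I_6) : dot a (delta_mx i 0) = a i 0.
Proof.
rewrite /dot (bigD1 i)//= big1 ?mxE ?eqxx ?mulr1 ?addr0// => s si.
by rewrite mxE (negbTE si) mulr0.
Qed.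

Lemma derive1_component_test i p y :
  derive1 (component_test i p) y = component_test i p^`() y.
Proof.
rewrite derive1E; apply/cvg_lim; first exact: norm_hausdorff.
rewrite /component_test derivE derive1E.
apply: (@cvg_trans _ ((fun h : R =>
  (h^-1 *: (p.[h *: 1 + y] - p.[y])) *: (delta_mx i 0 : 'cV[R]_6)) @ 0^')).
  by apply: near_eq_cvg; near=> h; rewrite /= -scalerBl scalerA.
by apply: cvgZr_tmp; exact: derivable_horner.
Unshelve. all: by end_near. Qed.

Lemma mulmx_represents (B : 'M[R]_6) u Z j i y :
  (j < N)%N -> xs j < y < xs j.+1 -> represents u Z ->
  (B *m Z y) i 0 = (\sum_s B i s *: u j s).[y].
Proof.
move=> jN jy uZ; rewrite mxE horner_sum; apply: eq_bigr => s _.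
by rewrite hornerZ (uZ j)// mxE.
Qed.

Lemma weak_driftE u Z j i p : (j < N)%N -> represents u Z ->
  weak_drift N xs m n Z (component_test i p) j = drift u j i p.
Proof.
move=> jN uZ; have N0 : (0 < N)%N by exact: leq_ltn_trans jN.
rewrite /weak_drift (KfluxE N0 jN uZ) (KfluxE N0 (ltnW jN) uZ).
have cm (l : nat) : continuous (component_test i p).
  by move=> y; apply: cvgZr_tmp; exact: continuous_horner.
have mm l : (l < N)%N -> forall y, xs l < y < xs l.+1 ->
    component_test i p y = component_test i p y.
  by [].
rewrite (tr_left_pieces N0 jN mm)// (tr_right_pieces N0 (ltnW jN) mm)// right_cell_lt//.
rewrite left_cellS !dotZr !dot_delta /drift -!(mulrC p.[_]).
rewrite /cell.
rewrite (@Rintegral_eq_poly_int _ _ _ ((\sum_s Kmat i s *: u j s) * p^`())); last first.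
  move=> y jy; rewrite derive1_component_test dotZr dot_delta.
  rewrite (mulmx_represents _ _ jN jy uZ) hornerM.
  by rewrite mulrC.
rewrite (@Rintegral_eq_poly_int _ _ _ ((\sum_s hessS1 i s *: u j s) * p))//.
by move=> y jy; rewrite dotZr dot_delta (mulmx_represents _ _ jN jy uZ) hornerM mulrC.
Qed.

Lemma Rintegral_Mmat_component u Z j i p : (j < N)%N -> represents u Z ->
  \int[mu]_(y in cell xs j) dot (Mmat *m Z y) (component_test i p y) =
  poly_int (xs j) (xs j.+1) ((\sum_s Mmat i s *: u j s) * p).
Proof.
move=> jN uZ; apply: Rintegral_eq_poly_int => y jy.
by rewrite dotZr dot_delta (mulmx_represents _ _ jN jy uZ) hornerM mulrC.
Qed.

(** The difference of the two one-sided expressions is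
    [K(U+ . V+ - U- . V-) - flux U . [V] + flux V . [U]]; the means cancel by
    antisymmetry of [K], and the jumps by symmetry of [A].  The average of the two
    sides is [F_K]. *)
Lemma interface_flux u v j :
  FK_pieces u v j = dot (Kmat *m left_trace u j) (left_trace v j)
              - dot (flux u j) (left_trace v j)
              + dot (flux v j) (left_trace u j)
  /\
  FK_pieces u v j = dot (Kmat *m right_trace u j) (right_trace v j)
              - dot (flux u j) (right_trace v j)
              + dot (flux v j) (right_trace u j).
Proof.
rewrite /FK_pieces /flux; move: (right_trace u j) (left_trace u j) => a b.
move: (right_trace v j) (left_trace v j) => a' b'.
rewrite !mulmxDr !mulmxN -!scalemxAr !mulmxDr.
rewrite !(dotDl, dotDr, dotZl, dotZr, dotNl).
have K := dot_antisym _ _ (@tr_Kmat R).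
have S := dot_sym _ _ (@tr_Amat R m n).
rewrite (K a' a) (K a' b) (K b' a) (K b' b) (S a' a) (S a' b) (S b' a) (S b' b).
by split; field.
Qed.

(** Green's formula: as [K] is antisymmetric, the left-hand integrand is the
    derivative of [dotp Kmat q q']. *)
Lemma dotp_antisym_deriv j (q q' : 'I_6 -> {poly R}) : (j < N)%N ->
  poly_int (xs j) (xs j.+1) (\sum_i (\sum_s Kmat i s *: q s) * (q' i)^`())
  - poly_int (xs j) (xs j.+1) (\sum_i (\sum_s Kmat i s *: q' s) * (q i)^`())
  = dot (Kmat *m eval_field q (xs j.+1)) (eval_field q' (xs j.+1))
    - dot (Kmat *m eval_field q (xs j)) (eval_field q' (xs j)).
Proof.
move=> jN; rewrite -linearB/= -!horner_dotp -poly_int_deriv ?hxs//; congr poly_int.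
have D (r : 'I_6 -> {poly R}) : (\sum_i r i)^`() = \sum_i (r i)^`().
  exact: (linear_sum (@deriv R)).
rewrite /dotp D; under [RHS]eq_bigr do rewrite derivM.
rewrite big_split/= addrC; congr (_ + _).
rewrite -sumrN.
under [RHS]eq_bigr do rewrite D mulr_suml.
under [LHS]eq_bigr do rewrite mulr_suml -sumrN.
rewrite exchange_big; apply: eq_bigr => i _; apply: eq_bigr => s _.
have /matrixP/(_ i s) := @tr_Kmat R; rewrite mxE [X in _ = X]mxE => ->.
by rewrite derivZ scaleNr mulNr opprK -!scalerAl mulrC.
Qed.

Lemma poly_int_hessian_sym j (q q' : 'I_6 -> {poly R}) :
  poly_int (xs j) (xs j.+1) (\sum_i (\sum_s hessS1 i s *: q s) * q' i) =
  poly_int (xs j) (xs j.+1) (\sum_i (\sum_s hessS1 i s *: q' s) * q i).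
Proof.
congr poly_int; under [LHS]eq_bigr do rewrite mulr_suml.
under [RHS]eq_bigr do rewrite mulr_suml.
rewrite exchange_big; apply: eq_bigr => i _; apply: eq_bigr => s _.
have /matrixP/(_ i s) := @tr_hessS1 R; rewrite [X in X = _]mxE => ->.
by rewrite -!scalerAl mulrC.
Qed.

Lemma sum_drift u v j : (j < N)%N ->
  \sum_i drift u j i (v j i) =
  poly_int (xs j) (xs j.+1) (\sum_i (\sum_s Kmat i s *: u j s) * (v j i)^`())
  - dot (flux u j.+1) (left_trace v j.+1) + dot (flux u j) (right_trace v j)
  + poly_int (xs j) (xs j.+1) (\sum_i (\sum_s hessS1 i s *: u j s) * v j i).
Proof.
move=> jN; rewrite /drift !big_split/= sumrN !linear_sum/=.
rewrite /left_trace /right_trace left_cellS right_cell_lt// /dot.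
by congr (_ + _ + _ + _); apply: eq_bigr => i _; rewrite [eval_field _ _ _ _]mxE.
Qed.

(** The multi-symplectic law before any time evolution is considered. *)
Lemma drift_antisym u v j : (j < N)%N ->
  \sum_i drift u j i (v j i) - \sum_i drift v j i (u j i) =
  FK_pieces u v j.+1 - FK_pieces u v j.
Proof.
move=> jN; rewrite !sum_drift// (poly_int_hessian_sym j (u j) (v j)).
rewrite (interface_flux u v j.+1).1 (interface_flux u v j).2.
have := dotp_antisym_deriv (u j) (v j) jN.
rewrite /left_trace /right_trace left_cellS right_cell_lt//.
by lra.
Qed.

Lemma drift_linear u j i : linear (drift u j i).
Proof.
move=> c p q; rewrite /drift derivD derivZ !mulrDr -!scalerAr !linearP/=.
by rewrite !hornerD !hornerZ /GRing.scale/=; ring.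
Qed.

HB.instance Definition _ u j i :=
  GRing.isLinear.Build R {poly R} R _ (drift u j i) (drift_linear u j i).

End PiecewisePolynomials.

(** * Coordinates of a discrete field *)

Section Pairing.
Context {R : realType}.
Variable d : nat.
Implicit Types x y : 'M[R]_(6, d).

Definition pairing x y : R := \sum_i \sum_a x i a * y i a.

Lemma pairingE x y : pairing x y = \tr (x^T *m y).
Proof.
rewrite /pairing exchange_big; apply: eq_bigr => a _; rewrite mxE.
by apply: eq_bigr => i _; rewrite mxE.
Qed.

(** Coordinate form of the antisymmetry of the pairing of [MU] with [V]. *)
Lemma pairing_adjoint (G : 'M[R]_d) x y : G^T = G ->
  pairing x (- (Mmat *m y *m G)) = - pairing y (- (Mmat *m x *m G)).
Proof.
move=> GS; rewrite !pairingE !mulmxN !raddfN/= opprK; apply/eqP.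
rewrite eqr_oppLR -mxtrace_tr !trmx_mul trmxK tr_Mmat GS !(mulmxN, mulNmx) raddfN/=.
by rewrite -mulmxA mxtrace_mulC !mulmxA.
Qed.

End Pairing.

Section Coefficients.
Context {R : realType}.
Variables (N : nat) (xs : nat -> R).
Hypothesis hxs : is_mesh N xs.
Variable k : nat.
Notation mu := (@lebesgue_measure R).
Implicit Types (Z : R -> 'cV[R]_6).

Notation d := k.+1.

Definition cell_gram l : 'M[R]_d := gram d (xs l) (xs l.+1).

(** Coordinates are defined as moments of the function rather than as chosen
    polynomial coefficients: the time regularity of the moments is what the
    weak form controls. *)
Definition moment_mx Z l : 'M[R]_(6, d) :=
  \matrix_(i, b) \int[mu]_(y in `[xs l, xs l.+1]) (Z y i 0 * y ^+ b).

Definition coef_mx Z l : 'M[R]_(6, d) := moment_mx Z l *m invmx (cell_gram l).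

Definition piece Z l (i : 'I_6) : {poly R} := rVpoly (row i (coef_mx Z l)).

(** A polynomial of degree at most [k] is determined by its first [k + 1]
    moments. *)
Lemma piece_represents Z : Vh6 N xs k Z -> represents N xs (piece Z) Z.
Proof.
move=> VZ l lN y ly; apply/colP => i; rewrite mxE.
have [p sp Zp] := VZ i l lN.
rewrite (Zp _ ly); congr (_.[y]).
rewrite {1}(poly_of_moments (hxs lN) sp) /piece /coef_mx row_mul; congr rVpoly.
congr (_ *m _); apply/rowP => b; rewrite !mxE.
rewrite -(@Rintegral_eq_poly_int _ _ _ _ (fun y => Z y i 0 * y ^+ b))// => s ls.
by rewrite hornerM hornerXn Zp.
Qed.

Lemma piece_sum Z l i : piece Z l i = \sum_a coef_mx Z l i a *: 'X^a.
Proof. by rewrite /piece rVpoly_sum; apply: eq_bigr => a _; rewrite mxE. Qed.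

Lemma poly_int_piece Z l i (b : 'I_d) : (l < N)%N ->
  poly_int (xs l) (xs l.+1) (piece Z l i * 'X^b) = moment_mx Z l i b.
Proof.
move=> lN; have := moments_rVpoly (xs l) (xs l.+1) (row i (coef_mx Z l)).
rewrite -row_mul /coef_mx mulmxKV ?gram_unitmx ?hxs// => /rowP/(_ b).
by rewrite !mxE.
Qed.

Definition Mmoment_mx Z l : 'M[R]_(6, d) := Mmat *m moment_mx Z l.

Lemma Rintegral_Mmoment Z l i (b : 'I_d) : (l < N)%N -> Vh6 N xs k Z ->
  \int[mu]_(y in cell xs l) dot (Mmat *m Z y) (component_test i 'X^b y) =
  Mmoment_mx Z l i b.
Proof.
move=> lN VZ; rewrite (Rintegral_Mmat_component _ _ lN (piece_represents VZ)).
rewrite mxE mulr_suml linear_sum.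
by apply: eq_bigr => s _; rewrite -scalerAl linearZ/= poly_int_piece.
Qed.

(** Recovers polynomial coefficients from the moments of [MZ], as far as the
    kernel of [M] permits. *)
Definition lower_coef_mx l (x : 'M[R]_(6, d)) : 'M[R]_(6, d) :=
  - (Mmat *m x *m invmx (cell_gram l)).

Lemma lower_coef_Mmoment Z l i a :
  lower_coef_mx l (Mmoment_mx Z l) i a = if (1 < i)%N then coef_mx Z l i a else 0.
Proof.
rewrite /lower_coef_mx /Mmoment_mx mulmxA Mmat_sqr -mulmxA -/(coef_mx Z l).
move: (coef_mx Z l) => c; rewrite !mxE.
rewrite (bigD1 i)//= big1 ?addr0; last first.
  by move=> s si; rewrite mxE eq_sym (negbTE si) mul0r.
by rewrite mxE eqxx/=; case: ifP => _; rewrite ?mulN1r ?opprK ?mul0r ?oppr0.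
Qed.

Lemma Mmoment_upper Z l (i : 'I_6) (a : 'I_d) : (i < 2)%N -> Mmoment_mx Z l i a = 0.
Proof. by move=> i2; rewrite mxE big1// => s _; rewrite Mmat_upper// mul0r. Qed.

(** The rows of [u] and [eta], in which [lower_coef_mx] is zero instead of the
    coefficients of [V], are paired with the zero rows of [MU]. *)
Lemma Mform_pairing U V l : (l < N)%N -> Vh6 N xs k U -> Vh6 N xs k V ->
  \int[mu]_(y in cell xs l) dot (Mmat *m U y) (V y) =
  pairing (Mmoment_mx U l) (lower_coef_mx l (Mmoment_mx V l)).
Proof.
move=> lN VU VV.
have rU := piece_represents VU; have rV := piece_represents VV.
rewrite (@Rintegral_eq_poly_int _ _ _ (dotp Mmat (piece U l) (piece V l))); last first.
  by move=> y ly; rewrite horner_dotp (rU l)// (rV l).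
rewrite /dotp linear_sum; apply: eq_bigr => i _.
rewrite piece_sum mulr_sumr linear_sum; apply: eq_bigr => a _.
rewrite -scalerAr linearZ/= -(Rintegral_Mmat_component _ _ lN rU) Rintegral_Mmoment//.
rewrite lower_coef_Mmoment [LHS]mulrC; case: ifP => // /negbT; rewrite -leqNgt => i2.
by rewrite Mmoment_upper// mul0r mulr0.
Qed.

Variables (m n : R).

Definition drift_mx Z l : 'M[R]_(6, d) :=
  \matrix_(i, b) weak_drift N xs m n Z (component_test i 'X^b) l.

Lemma FK_diff_pairing U V l : (l < N)%N -> Vh6 N xs k U -> Vh6 N xs k V ->
  FK N xs m n U V l.+1 - FK N xs m n U V l =
  pairing (drift_mx U l) (coef_mx V l) - pairing (drift_mx V l) (coef_mx U l).
Proof.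
move=> lN VU VV; have N0 : (0 < N)%N by exact: leq_ltn_trans lN.
have rU := piece_represents VU; have rV := piece_represents VV.
rewrite !(FK_of_pieces hxs m n N0 _ rU rV) ?(ltnW lN)//.
rewrite -drift_antisym// /pairing.
have E Z W : represents N xs (piece Z) Z ->
    \sum_i drift N xs m n (piece Z) l i (piece W l i) =
    \sum_i \sum_a drift_mx Z l i a * coef_mx W l i a.
  move=> rZ; apply: eq_bigr => i _; rewrite piece_sum linear_sum.
  apply: eq_bigr => a _; rewrite linearZ/= [drift_mx _ _ _ _]mxE.
  rewrite (weak_driftE _ _ _ _ _ lN rZ)//.
  by rewrite mulrC.
by congr (_ - _); exact: E.
Qed.

End Coefficients.

(** * Evolution along one sample path *)

Section Path.
Context {R : realType}.
Variables (N : nat) (xs : nat -> R).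
Hypothesis hxs : is_mesh N xs.
Variables (k : nat) (m n T : R).
Hypothesis T0 : 0 < T.
Notation mu := (@lebesgue_measure R).
Notation d := k.+1.

(** Finitely many test functions suffice, so that the exceptional null sets of
    paths, which depend on the test function, can be united. *)
Definition path_solution (Z : R -> R -> 'cV[R]_6) :=
  (forall t, 0 <= t <= T -> Vh6 N xs k (Z t)) /\
  (forall (l : 'I_N) (i : 'I_6) (b : 'I_d), differential_dt T
     (fun t => \int[mu]_(y in cell xs l) dot (Mmat *m Z t y) (component_test i 'X^b y))
     (fun t => weak_drift N xs m n (Z t) (component_test i 'X^b) l)).

Section OneSolution.
Variable Z : R -> R -> 'cV[R]_6.
Hypothesis hZ : path_solution Z.

Lemma differential_Mmoment l i b : (l < N)%N -> differential_dt T
  (fun t => Mmoment_mx xs k (Z t) l i b) (fun t => drift_mx N xs k m n (Z t) l i b).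
Proof.
move=> lN; have := hZ.2 (Ordinal lN) i b.
rewrite (_ : (fun t => weak_drift _ _ _ _ _ _ _) =
  fun t => drift_mx N xs k m n (Z t) l i b).
  apply: differential_dt_ext; first exact: ltW.
  by move=> t tT /=; apply: (Rintegral_Mmoment hxs) => //; exact: hZ.1.
by apply/funext => t; rewrite mxE.
Qed.

Lemma differential_lower_coef l i a : (l < N)%N -> differential_dt T
  (fun t => lower_coef_mx xs l (Mmoment_mx xs k (Z t) l) i a)
  (fun t => lower_coef_mx xs l (drift_mx N xs k m n (Z t) l) i a).
Proof.
move=> lN.
have dualE (x : 'M[R]_(6, d)) : lower_coef_mx xs l x i a =
    \sum_b \sum_s (- (Mmat i s * invmx (cell_gram xs k l) b a)) * x s b.
  rewrite mxE mxE -sumrN; apply: eq_bigr => b _; rewrite mxE mulr_suml -sumrN.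
  by apply: eq_bigr => s _; ring.
rewrite (funext (fun t => dualE (Mmoment_mx xs k (Z t) l))).
rewrite (funext (fun t => dualE (drift_mx N xs k m n (Z t) l))).
apply: differential_dt_sum => b; apply: differential_dt_sum => s.
by apply: differential_dtZ; exact: differential_Mmoment.
Qed.

Lemma measurable_drift_mx l i b : (l < N)%N ->
  measurable_fun `[0, T] (fun t => drift_mx N xs k m n (Z t) l i b).
Proof.
move=> lN; have [+ _] := differential_Mmoment i b lN.
exact: measurable_integrand.
Qed.

Lemma measurable_lower_coef l (i : 'I_6) a : (l < N)%N -> (1 < i)%N ->
  measurable_fun `[0, T] (fun t => coef_mx xs k (Z t) l i a).
Proof.
move=> lN i1.
have c := differential_dt_continuous (ltW T0) (differential_lower_coef i a lN).
have mc : measurable_fun `[0, T]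
    (fun t => lower_coef_mx xs l (Mmoment_mx xs k (Z t) l) i a).
  exact: (subspace_continuous_measurable_fun _ c).
by apply: eq_measurable_fun mc => t _; rewrite lower_coef_Mmoment i1.
Qed.

Lemma measurable_linear_piece (f : {poly R} -> R) l (i : 'I_6) : linear f ->
  (l < N)%N -> (1 < i)%N -> measurable_fun `[0, T] (fun t => f (piece xs k (Z t) l i)).
Proof.
move=> lf lN i1.
pose F : {linear {poly R} -> R} :=
  HB.pack f (GRing.isLinear.Build R {poly R} R _ f lf).
rewrite -[f]/(F : _ -> _).
under [X in measurable_fun _ X]eq_fun do rewrite piece_sum linear_sum.
apply: measurable_sum => a.
under [X in measurable_fun _ X]eq_fun do rewrite linearZ/=.
by apply: measurable_funM => //; exact: measurable_lower_coef.
Qed.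

(** Applied to the rows of [u] and [eta], for which only the last four
    components, known to be continuous in time, contribute. *)
Lemma measurable_upper_row (B : 'I_6 -> R) (c : 'I_6 -> R -> R) :
  (forall s : 'I_6, (s < 2)%N -> B s = 0) ->
  (forall s : 'I_6, (1 < s)%N -> measurable_fun `[0, T] (c s)) ->
  measurable_fun `[0, T] (fun t => \sum_s B s * c s t).
Proof.
move=> B0 mc; apply: measurable_sum => s.
have [s2|s2] := ltnP s 2; last by apply: measurable_funM => //; exact: mc.
by under [X in measurable_fun _ X]eq_fun do rewrite B0// mul0r; exact: measurable_cst.
Qed.

Lemma measurable_upper_flux j (i : 'I_6) : (0 < N)%N -> (j <= N)%N -> (i < 2)%N ->
  measurable_fun `[0, T] (fun t => flux N xs m n (piece xs k (Z t)) j i 0).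
Proof.
move=> N0 jN i2.
have mL (s : 'I_6) : (1 < s)%N ->
    measurable_fun `[0, T] (fun t => left_trace N xs (piece xs k (Z t)) j s 0).
  move=> s1; under [X in measurable_fun _ X]eq_fun do rewrite mxE.
  apply: (@measurable_linear_piece (horner_eval (xs (left_cell N j).+1))) => //.
    exact: linearP.
  exact: left_cell_ltn.
have mR (s : 'I_6) : (1 < s)%N ->
    measurable_fun `[0, T] (fun t => right_trace N xs (piece xs k (Z t)) j s 0).
  move=> s1; under [X in measurable_fun _ X]eq_fun do rewrite mxE.
  apply: (@measurable_linear_piece (horner_eval (xs (right_cell N j)))) => //.
    exact: linearP.
  exact: right_cell_ltn.
rewrite /flux; under [X in measurable_fun _ X]eq_fun do
  rewrite mxE [X in X + _]mxE [X in _ + X]mxE.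
apply: measurable_funD; apply: measurable_upper_row => s s1.
- exact: Kmat_upper.
- under [X in measurable_fun _ X]eq_fun do rewrite mxE mxE.
  by apply: measurable_funM => //; apply: measurable_funD; [exact: mR|exact: mL].
- exact: Amat_upper.
- under [X in measurable_fun _ X]eq_fun do rewrite mxE [X in _ + X]mxE.
  by apply: measurable_funB; [exact: mR|exact: mL].
Qed.

(** The equation tested with [u] or [eta] is solved for the moment of [u] or
    [eta], using that the Hessian contains it with coefficient [-1].  All other
    terms are measurable in time: the drift because it is integrable, the remaining ones
    because they involve [v], [zeta], [P], [Q] only. *)
Lemma measurable_upper_moment l (i : 'I_6) b : (l < N)%N -> (i < 2)%N ->
  measurable_fun `[0, T] (fun t => moment_mx xs k (Z t) l i b).
Proof.
move=> lN i2; have N0 : (0 < N)%N by exact: leq_ltn_trans lN.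
pose K t := \sum_s Kmat i s *
  poly_int (xs l) (xs l.+1) (piece xs k (Z t) l s * ('X^b)^`()).
(* Adding the Kronecker symbol to the Hessian row removes the unknown moment. *)
pose H t := \sum_s (hessS1 i s + (i == s)%:R) *
  poly_int (xs l) (xs l.+1) (piece xs k (Z t) l s * 'X^b).
pose F j t := flux N xs m n (piece xs k (Z t)) j i 0.
have mp p (s : 'I_6) : (1 < s)%N -> measurable_fun `[0, T]
    (fun t => poly_int (xs l) (xs l.+1) (piece xs k (Z t) l s * p)).
  move=> s1.
  apply: (@measurable_linear_piece (fun q => poly_int (xs l) (xs l.+1) (q * p))) => //.
  by move=> c q r; rewrite mulrDl -scalerAl linearP.
have mK : measurable_fun `[0, T] K.
  by apply: measurable_upper_row => s s1; [exact: Kmat_upper|exact: mp].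
have mH : measurable_fun `[0, T] H.
  apply: measurable_upper_row => s s1; last exact: mp.
  by rewrite hessS1_upper// addNr.
have mF j : (j <= N)%N -> measurable_fun `[0, T] (F j).
  by move=> jN; exact: measurable_upper_flux.
apply: (@eq_measurable_fun _ _ _ _ _ (fun t => K t - F l.+1 t * ('X^b).[xs l.+1]
   + F l t * ('X^b).[xs l] + H t - drift_mx N xs k m n (Z t) l i b)); last first.
  apply: measurable_funB; last exact: measurable_drift_mx.
  apply: measurable_funD => //; apply: measurable_funD.
    by apply: measurable_funB => //; apply: measurable_funM => //; exact: mF.
  by apply: measurable_funM => //; apply: mF; exact: ltnW.
move=> t; rewrite inE/= in_itv/= => tT.
rewrite [drift_mx _ _ _ _ _ _ _ _ _]mxE.
rewrite (weak_driftE hxs _ _ _ _ lN (piece_represents hxs (hZ.1 _ tT))).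
rewrite /drift.
have -> : poly_int (xs l) (xs l.+1)
    ((\sum_s Kmat i s *: piece xs k (Z t) l s) * ('X^b)^`()) = K t.
  rewrite mulr_suml linear_sum; apply: eq_bigr => s _.
  by rewrite -scalerAl linearZ.
have -> : H t = poly_int (xs l) (xs l.+1)
    ((\sum_s hessS1 i s *: piece xs k (Z t) l s) * 'X^b) + moment_mx xs k (Z t) l i b.
  rewrite mulr_suml linear_sum /H -(poly_int_piece hxs)//.
  under eq_bigr do rewrite mulrDl.
  rewrite big_split/=; congr (_ + _).
    by apply: eq_bigr => s _; rewrite -scalerAl linearZ.
  rewrite (bigD1 i)//= eqxx mul1r big1 ?addr0// => s si.
  by rewrite eq_sym (negbTE si) mul0r.
by rewrite /F; ring.
Qed.

Lemma measurable_coef_mx l i a : (l < N)%N ->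
  measurable_fun `[0, T] (fun t => coef_mx xs k (Z t) l i a).
Proof.
move=> lN; have [i2|i2] := ltnP i 2; last exact: measurable_lower_coef.
rewrite /coef_mx; under [X in measurable_fun _ X]eq_fun do rewrite mxE.
apply: measurable_sum => b; apply: measurable_funM => //.
exact: measurable_upper_moment.
Qed.

(** Algebraic constraints of the system: [M] has no [u] and [eta] rows, so the
    drift of these rows integrates to zero over every time interval. *)
Lemma upper_drift_ae_eq0 l : (l < N)%N -> {ae mu, forall t, forall (i : 'I_6) (b : 'I_d),
  (i < 2)%N -> 0 <= t <= T -> drift_mx N xs k m n (Z t) l i b = 0}.
Proof.
move=> lN.
have FF : Filter (almost_everywhere mu) by exact: (ae_filter_ringOfSetsType mu).
apply: filter_forall => i; apply: filter_forall => b.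
have [i2|i2] := ltnP i 2; last by apply: nearW.
have [iD XD] := differential_Mmoment i b lN.
have := ae_eq0_of_Rintegral0 iD.
have D0 t : 0 <= t <= T ->
    \int[mu]_(s in `[0, t]) drift_mx N xs k m n (Z s) l i b = 0.
  move=> tT; have := XD t tT; by rewrite !Mmoment_upper// add0r => <-.
move=> /(_ D0); apply: filterS => t h _; exact: h.
Qed.

End OneSolution.

Lemma multisymplectic_path U V l : path_solution U -> path_solution V -> (l < N)%N ->
  differential_dt T (fun t => \int[mu]_(y in cell xs l) dot (Mmat *m U t y) (V t y))
    (fun t => FK N xs m n (U t) (V t) l.+1 - FK N xs m n (U t) (V t) l).
Proof.
move=> hU hV lN.
have T0' := ltW T0.
have tr_inv : (invmx (cell_gram xs k l))^T = invmx (cell_gram xs k l).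
  by rewrite trmx_inv tr_gram.
pose XU t := Mmoment_mx xs k (U t) l; pose XV t := Mmoment_mx xs k (V t) l.
pose DU t := drift_mx N xs k m n (U t) l; pose DV t := drift_mx N xs k m n (V t) l.
(* The product rule, with the derivative of the second factor moved onto the
   first one by antisymmetry. *)
have dpairing : differential_dt T (fun t => pairing (XU t) (lower_coef_mx xs l (XV t)))
    (fun t => pairing (DU t) (lower_coef_mx xs l (XV t))
            - pairing (DV t) (lower_coef_mx xs l (XU t))).
  have := (fun i a => differential_dtM T0' (differential_Mmoment hU i a lN)
    (differential_lower_coef hV i a lN)).
  move=> /(fun h i => differential_dt_sum (index_enum 'I_d) (h i)).
  move=> /(differential_dt_sum (index_enum 'I_6)).
  congr (differential_dt _ _ _); apply/funext => t.
  rewrite -pairing_adjoint// /pairing -big_split; apply: eq_bigr => i _.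
  by rewrite -big_split.
apply: differential_dt_ext T0' _ _.
  by move=> t tT; rewrite (Mform_pairing hxs lN (hU.1 _ tT) (hV.1 _ tT)).
apply: differential_dt_ae dpairing _ _.
  apply: (@eq_measurable_fun _ _ _ _ _ (fun t =>
    pairing (DU t) (coef_mx xs k (V t) l) - pairing (DV t) (coef_mx xs k (U t) l))).
    move=> t; rewrite inE/= in_itv/= => tT.
    by rewrite (FK_diff_pairing hxs _ _ lN (hU.1 _ tT) (hV.1 _ tT)).
  apply: measurable_funB; apply: measurable_sum => i; apply: measurable_sum => a;
    apply: measurable_funM; by [exact: measurable_drift_mx|exact: measurable_coef_mx].
(* The two sums differ by terms with a vanishing upper row of the drift. *)
have FF : Filter (almost_everywhere mu) by exact: (ae_filter_ringOfSetsType mu).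
apply: filterS2 (upper_drift_ae_eq0 hU lN) (upper_drift_ae_eq0 hV lN) => t tU tV tT.
rewrite (FK_diff_pairing hxs _ _ lN (hU.1 _ tT) (hV.1 _ tT)).
congr (_ - _); apply: eq_bigr => i _; apply: eq_bigr => a _; rewrite lower_coef_Mmoment;
  case: ifP => // /negbT; rewrite -leqNgt => i2.
- by rewrite /DU (tU i a i2 tT) !mul0r.
- by rewrite /DV (tV i a i2 tT) !mul0r.
Qed.

End Path.

Theorem theorem2p4 (R : realType) (d : measure_display)
    (Omega : measurableType d) (P : probability Omega R)
    (T : R) (hT : 0 < T)
    (N : nat) (xs : nat -> R) (hxs : is_mesh N xs) (k : nat)
    (alpha m n : R) (halpha : -1 <= alpha <= 1) (halpha0 : alpha != 0)
    (hmn : n - m = alpha)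
    (U V : R -> Omega -> R -> 'cV[R]_6)
    (hU : variational_solution P T N xs k m n U)
    (hV : variational_solution P T N xs k m n V)
    (j : nat) (hj : (j < N)%N) :
  {ae P, forall w, differential_dt T
    (fun t => \int[lebesgue_measure]_(y in cell xs j)
                dot (Mmat *m U t w y) (V t w y))
    (fun t => FK N xs m n (U t w) (V t w) j.+1
              - FK N xs m n (U t w) (V t w) j)}.
Proof.
have FF : Filter (almost_everywhere P) by exact: (ae_filter_ringOfSetsType P).
have test (i : 'I_6) (b : 'I_k.+1) : Vh6 N xs k (component_test i 'X^b).
  move=> s l lN; exists ((s == i)%:R *: 'X^b).
    by apply: (leq_trans (size_scale_leq _ _)); rewrite size_polyXn ltn_ord.
  by move=> y _; rewrite /component_test !mxE hornerZ eqxx andbT mulrC.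
have path Z : variational_solution P T N xs k m n Z ->
    {ae P, forall w, path_solution N xs k m n T (fun t => Z t w)}.
  move=> [VZ dZ].
  have : {ae P, forall w, forall (l : 'I_N) (i : 'I_6) (b : 'I_k.+1), differential_dt T
     (fun t => \int[lebesgue_measure]_(y in cell xs l)
        dot (Mmat *m Z t w y) (component_test i 'X^b y))
     (fun t => weak_drift N xs m n (Z t w) (component_test i 'X^b) l)}.
    apply: filter_forall => l; apply: filter_forall => i; apply: filter_forall => b.
    exact: dZ.
  by apply: filterS => w h; split => // t tT; exact: VZ.
apply: filterS2 (path _ hU) (path _ hV) => w hUw hVw.
exact: (multisymplectic_path hxs hT hUw hVw hj).
Qed.
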